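(* Let $A_{n,k}(q)$ denote the $q$-Eulerian numbers defined below. For any positive integers $a$ and $b$, $$\sum_{k\geq 0}{\begin{bmatrix} a+b\\ k\end{bmatrix}}_q A_{k,a-1}(q)=\sum_{k\geq 0}{\begin{bmatrix} a+b\\ k\end{bmatrix}}_q A_{k,b-1}(q).$$
   Context: For a positive integer $n$ let $(z;q)_n=\prod_{i=0}^{n-1}(1-zq^i)$, and $(z;q)_0=1$. The $q$-exponential function is $e(z;q)=\sum_{n\geq 0} z^n/(q;q)_n$. The $q$-Eulerian polynomials $A_n(t,q)$ are defined by the generating function $$\sum_{n\geq 0}A_n(t,q)\frac{z^n}{(q;q)_n}=\frac{e(z;q)-e(tz;q)}{e(tz;q)-t\,e(z;q)}$$ (so in particular $A_0(t,q)=0$), and the $q$-Eulerian numbers $A_{n,k}(q)$ are their coefficients: $A_n(t,q)=\sum_{k=0}^n A_{n,k}(q)t^k$, with $A_{n,k}(q)=0$ for $k<0$ or $k>n$. The $q$-binomial coefficient is ${\begin{bmatrix} n\\ k\end{bmatrix}}_q=\frac{(q;q)_n}{(q;q)_{n-k}(q;q)_k}$ for $0\le k\le n$ and $0$ if $k<0$ or $k>n$. *)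

(* Defs.v *)
From HB Require Import structures.
From mathcomp Require Import all_boot all_order all_algebra.

Set Implicit Arguments.
Unset Strict Implicit.
Unset Printing Implicit Defensive.

Import GRing.Theory.
Local Open Scope ring_scope.
Local Open Scope quotient_scope.

Notation "x %:F" := (@FracField.tofrac _ x) : ring_scope.

(* Formal power series in z over F are coefficient sequences nat -> F. *)

Definition fps_mul (R : nzRingType) (f g : nat -> R) (n : nat) : R :=
  \sum_(i < n.+1) f i * g (n - i)%N.

(* The first n coefficients of f / g, by long division. *)
Fixpoint fps_div_prefix (F : fieldType) (f g : nat -> F) (n : nat) : seq F :=
  if n is m.+1 then
    let s := fps_div_prefix f g m in
    rcons s ((f m - \sum_(i < m) s`_i * g (m - i)%N) / g 0%N)
  else [::].

(* The quotient power series f / g, meaningful when g 0 != 0; see fps_divK. *)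
Definition fps_div (F : fieldType) (f g : nat -> F) (n : nat) : F :=
  (fps_div_prefix f g n.+1)`_n.

Definition qpoch (R : comNzRingType) (z q : R) (n : nat) : R :=
  \prod_(i < n) (1 - z * q ^+ i).

Definition qbinom (F : fieldType) (q : F) (n k : nat) : F :=
  if (k <= n)%N then qpoch q q n / (qpoch q q (n - k) * qpoch q q k) else 0.

(* The power series e(w z; q) in z. *)
Definition qexp (F : fieldType) (w q : F) (n : nat) : F :=
  w ^+ n / qpoch q q n.

(* The power series (e(z;q) - e(tz;q)) / (e(tz;q) - t e(z;q)) in z. *)
Definition qEulerian_gf (F : fieldType) (t q : F) : nat -> F :=
  fps_div (fun n => qexp 1 q n - qexp t q n)
          (fun n => qexp t q n - t * qexp 1 q n).

(* The polynomial p such that c = p%:F, when there is one; see polyfracK. *)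
Definition polyfrac (F : fieldType) (c : {fraction {poly F}}) : {poly F} :=
  \n_(repr c) %/ \d_(repr c).

(* A_n(t,q) as a polynomial in t over F: the generating function is a power
   series over F(t), and its n-th coefficient times (q;q)_n lies in F[t]; see
   qEulerian_polyE. *)
Definition qEulerian_poly (F : fieldType) (q : F) (n : nat) : {poly F} :=
  let qt : {fraction {poly F}} := q%:P%:F in
  polyfrac (qEulerian_gf 'X%:F qt n * qpoch qt qt n).

Definition qEulerian (F : fieldType) (q : F) (n k : nat) : F :=
  (qEulerian_poly q n)`_k.

Definition Qq : fieldType := {fraction {poly rat}}.
Definition qvar : Qq := ('X : {poly rat})%:F.

Section Sanity.

Lemma size_fps_div_prefix (F : fieldType) (f g : nat -> F) n :
  size (fps_div_prefix f g n) = n.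
Proof. by elim: n => //= n IHn; rewrite size_rcons IHn. Qed.

Lemma nth_fps_div_prefix (F : fieldType) (f g : nat -> F) n i :
  (i < n)%N -> (fps_div_prefix f g n)`_i = fps_div f g i.
Proof.
elim: n => // n IHn; rewrite ltnS leq_eqVlt => /predU1P[-> //|lt_in].
by rewrite /= nth_rcons size_fps_div_prefix lt_in IHn.
Qed.

Lemma fps_div_rec (F : fieldType) (f g : nat -> F) n :
  fps_div f g n =
    (f n - \sum_(i < n) fps_div f g i * g (n - i)%N) / g 0%N.
Proof.
rewrite {1}/fps_div /= nth_rcons size_fps_div_prefix ltnn eqxx.
by congr ((_ - _) / _); apply: eq_bigr => i _; rewrite nth_fps_div_prefix.
Qed.

Lemma fps_divK (F : fieldType) (f g : nat -> F) n :
  g 0%N != 0 -> fps_mul (fps_div f g) g n = f n.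
Proof.
move=> g0; rewrite /fps_mul big_ord_recr /= subnn fps_div_rec divfK //.
by rewrite addrCA subrr addr0.
Qed.

Lemma polyfracK (F : fieldType) (p : {poly F}) : polyfrac p%:F = p.
Proof.
have /eqP := FracField.equivf_l (Ratio p 1).
rewrite !numden_Ratio ?oner_eq0 // mulr1 -/(FracField.type _).
have -> : \pi_({fraction {poly F}}) (Ratio p 1) = p%:F.
  by rewrite /FracField.tofrac; unlock.
by rewrite /polyfrac => /eqP ->; rewrite mulKp // denom_ratioP.
Qed.

Variables (F : fieldType) (q : F).
Hypothesis q_neq1 : forall n : nat, (0 < n)%N -> q ^+ n != 1.

Local Notation qt := (q%:P%:F : {fraction {poly F}}).
Local Notation t := ('X%:F : {fraction {poly F}}).

Lemma qpoch_neq0 n : qpoch q q n != 0.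
Proof.
rewrite /qpoch; apply/prodf_neq0 => i _.
by rewrite -exprS subr_eq0 eq_sym q_neq1.
Qed.

Lemma qpoch_frac n : qpoch qt qt n = (qpoch q q n)%:P%:F.
Proof.
rewrite /qpoch !rmorph_prod; apply: eq_bigr => i _ /=.
by rewrite -rmorphXn -rmorphM -(rmorph1 (@FracField.tofrac {poly F})) -rmorphB /=
           -polyC_exp -polyCM -polyCB.
Qed.

Lemma qpochV_frac n : (qpoch qt qt n)^-1 = ((qpoch q q n)^-1)%:P%:F.
Proof.
have h : qpoch qt qt n != 0 by rewrite qpoch_frac tofrac_eq0 polyC_eq0 qpoch_neq0.
apply: (mulfI h); rewrite divff // qpoch_frac -!rmorphM /= divff ?qpoch_neq0 //.
Qed.

Lemma fracX_neq1 : 1 - t != 0.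
Proof.
rewrite -(rmorph1 (@FracField.tofrac {poly F})) -rmorphB tofrac_eq0 subr_eq0.
by apply/eqP => /(congr1 (fun p : {poly F} => size p)); rewrite size_poly1 size_polyX.
Qed.

Lemma qexp0 (K : fieldType) (w r : K) : qexp w r 0 = 1.
Proof. by rewrite /qexp /qpoch big_ord0 expr0 divr1. Qed.

Lemma qEulerian_gf_poly n :
  exists2 p : {poly F}, (size p <= n)%N & qEulerian_gf t qt n = p%:F.
Proof.
have sz1 k : (size (\sum_(i < k) 'X^i : {poly F})%R <= k)%N.
  apply: (leq_trans (size_sum _ _ _)); apply/bigmax_leqP => i _.
  by rewrite size_polyXn.
have geo k : (1 - t) * (\sum_(i < k) 'X^i : {poly F})%:F = 1 - t ^+ k.
  rewrite -opprB -[RHS]opprB subrX1 mulNr rmorph_sum /=; congr (- (_ * _)).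
  by apply: eq_bigr => i _; rewrite rmorphXn.
elim/ltn_ind: n => n IHn.
pose P i := polyfrac (qEulerian_gf t qt i).
have Ps i : (i < n)%N -> (size (P i) <= i)%N.
  by move=> /IHn[p sp e]; rewrite /P e polyfracK.
have PE i : (i < n)%N -> qEulerian_gf t qt i = (P i)%:F.
  by move=> /IHn[p sp e]; rewrite /P e polyfracK.
exists ((qpoch q q n)^-1 *: (\sum_(i < n) 'X^i) +
   \sum_(i < n) P i * ((qpoch q q (n - i))^-1 *: ('X * \sum_(j < (n - i).-1) 'X^j))).
  apply: (leq_trans (size_polyD _ _)); rewrite geq_max.
  rewrite (leq_trans (size_scale_leq _ _) (sz1 n)) /=.
  apply: (leq_trans (size_sum _ _ _)); apply/bigmax_leqP => i _.
  apply: (leq_trans (size_polyMleq _ _)).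
  have h : (size ((qpoch q q (n - i))^-1 *: ('X * \sum_(j < (n - i).-1) 'X^j : {poly F}))%R <= n - i)%N.
    apply: (leq_trans (size_scale_leq _ _)); apply: (leq_trans (size_polyMleq _ _)).
    rewrite size_polyX /=; apply: leq_ltn_trans (sz1 _) _.
    by rewrite prednK ?subn_gt0.
  rewrite -subn1 leq_subLR; apply: leq_trans (leq_add (Ps _ (ltn_ord i)) h) _.
  by rewrite subnKC ?leqnSn // ltnW.
apply: (mulfI fracX_neq1).
rewrite /qEulerian_gf fps_div_rec -/(qEulerian_gf t qt) !qexp0 mulr1.
rewrite mulrC divfK ?fracX_neq1 //.
rewrite rmorphD mulrDr rmorph_sum /= mulr_sumr; congr (_ + _).
  by rewrite -mul_polyC rmorphM /= mulrCA geo /qexp -qpochV_frac expr1n -mulrBl mulrC.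
rewrite -sumrN; apply: eq_bigr => i _.
have n_i : (0 < n - i)%N by rewrite subn_gt0.
rewrite -/(qEulerian_gf t qt i) PE // -mul_polyC !rmorphM /= -qpochV_frac.
rewrite [RHS]mulrCA -mulrN; congr (_ * _).
rewrite [RHS]mulrCA [X in _ = _ * X]mulrCA geo /qexp expr1n mulrBr mulr1 -exprS prednK //.
by rewrite mulrA mulr1 -mulrBl -mulNr opprB mulrC.
Qed.

Lemma qEulerian_polyE n :
  (qEulerian_poly q n)%:F / qpoch qt qt n = qEulerian_gf t qt n.
Proof.
have [p _ e] := qEulerian_gf_poly n.
rewrite /qEulerian_poly e {1}qpoch_frac -rmorphM polyfracK rmorphM /= -qpoch_frac.
by rewrite mulfK // qpoch_frac tofrac_eq0 polyC_eq0 qpoch_neq0.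
Qed.

Lemma size_qEulerian_poly n : (size (qEulerian_poly q n) <= n)%N.
Proof.
have [p sp e] := qEulerian_gf_poly n.
rewrite /qEulerian_poly e qpoch_frac -rmorphM polyfracK mulrC mul_polyC.
exact: leq_trans (size_scale_leq _ _) sp.
Qed.

End Sanity.

Lemma qvar_neq1 n : (0 < n)%N -> qvar ^+ n != 1.
Proof.
move=> n0; rewrite /qvar -rmorphXn -(rmorph1 (@FracField.tofrac {poly rat})).
rewrite tofrac_eq; apply/eqP => /(congr1 (fun p : {poly rat} => size p)).
by rewrite size_polyXn size_poly1 => -[] n_0; rewrite n_0 in n0.
Qed.

(* Main.v *)
From HB Require Import structures.
Require Import Defs.
From mathcomp Require Import all_boot all_order all_algebra.

Set Implicit Arguments.
Unset Strict Implicit.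
Unset Printing Implicit Defensive.

Import GRing.Theory.
Local Open Scope ring_scope.

(** Clearing denominators in the generating function gives
    [sum_k [n,k] A_k(t) (t^(n-k) - t) = 1 - t^n].  The right-hand side changes
    sign under [f(t) |-> t^n f(1/t)], and so does the summand of index [k < n]
    if [t^k A_k(1/t) = t A_k(t)]; hence so does the last summand
    [A_n(t) (1 - t)], and induction on [n] gives this symmetry for all [n].
    With it, the coefficient of [t^a] in the identity for [n = a + b] is the
    claim. *)

Section ReciprocalPolynomial.

Variable R : comNzRingType.
Implicit Types p r : {poly R}.

(* [t^n p(1/t)], provided that [p] has degree at most [n]; coefficients of
   higher degree are dropped. *)
Definition recip_poly n p : {poly R} := \poly_(i < n.+1) p`_(n - i).

Lemma coef_recip_poly n p i : (i <= n)%N -> (recip_poly n p)`_i = p`_(n - i).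
Proof. by move=> le_in; rewrite coef_poly ltnS le_in. Qed.

Lemma recip_poly_is_linear n : linear (recip_poly n).
Proof.
move=> c p r; apply/polyP=> i; rewrite coefD coefZ !coef_poly.
by case: ifP => _; rewrite ?mulr0 ?addr0 // coefD coefZ.
Qed.

HB.instance Definition _ n :=
  GRing.isLinear.Build R {poly R} {poly R} _ (recip_poly n)
    (recip_poly_is_linear n).

Lemma recip_polyXn n i : (i <= n)%N -> recip_poly n 'X^i = 'X^(n - i).
Proof.
move=> le_in; apply/polyP=> j; rewrite coef_poly !coefXn ltnS.
case: leqP => [le_jn | lt_nj].
  rewrite -(eqn_add2r j) subnK // -[in RHS](eqn_add2r i) subnK //.
  by rewrite addnC eq_sym.
by rewrite gtn_eqF // (leq_ltn_trans (leq_subr i n)).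
Qed.

Lemma recip_poly1 n : recip_poly n 1 = 'X^n.
Proof. by rewrite -(expr0 'X) recip_polyXn ?subn0. Qed.

Lemma recip_polyX n : (0 < n)%N -> recip_poly n 'X = 'X^(n.-1).
Proof. by move=> n_gt0; rewrite -[in LHS](expr1 'X) recip_polyXn ?subn1. Qed.

Lemma recip_polyM m n p r : (size p <= m.+1)%N -> (size r <= n.+1)%N ->
  recip_poly (m + n) (p * r) = recip_poly m p * recip_poly n r.
Proof.
move=> size_p size_r; rewrite -(take_poly_id size_p) -(take_poly_id size_r).
rewrite /take_poly !poly_def.
rewrite mulr_suml !linear_sum mulr_suml; apply: eq_bigr => i _ /=.
rewrite !mulr_sumr linear_sum; apply: eq_bigr => j _ /=.
rewrite -scalerAl -scalerAr -exprD !linearZ /= -scalerAl -scalerAr.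
rewrite !recip_polyXn ?leq_add ?leq_ord // -exprD.
by rewrite addnBA ?leq_ord // addnBAC ?leq_ord // subnDA.
Qed.

Lemma recip_polyS n p :
  (size p <= n.+1)%N -> recip_poly n.+1 p = 'X * recip_poly n p.
Proof.
move=> size_p; rewrite -{1}[p]mulr1 -addn1 recip_polyM ?size_poly1 //.
by rewrite recip_poly1 mulrC.
Qed.

Lemma recip_polyM_XnBX_antisym k m p :
    (0 < m)%N -> (size p <= k.+1)%N -> recip_poly k p = 'X * p ->
  recip_poly (k + m) (p * ('X^m - 'X)) = - (p * ('X^m - 'X)).
Proof.
move=> m_gt0 size_p recip_p.
have size_XnBX : (size ('X^m - 'X : {poly R})%R <= m.+1)%N.
  rewrite (leq_trans (size_polyD _ _)) // size_polyN size_polyXn size_polyX.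
  by rewrite geq_max leqnn.
rewrite recip_polyM // recip_p linearB /= recip_polyXn // recip_polyX //.
rewrite subnn expr0 mulrAC mulrBr mulr1 -exprS prednK //.
by rewrite mulrC -mulrN opprB.
Qed.

Lemma recip_polyM_1BX n p : (size p <= n.+1)%N ->
  recip_poly n.+1 (p * (1 - 'X)) = - (recip_poly n p * (1 - 'X)).
Proof.
move=> size_p; rewrite -addn1 recip_polyM //; last first.
  by rewrite -opprB size_polyN -polyC1 size_XsubC.
by rewrite linearB /= recip_poly1 recip_polyX // -mulrN opprB.
Qed.

Lemma recip_polyXnM m n p :
  (size p <= n.+1)%N -> recip_poly (m + n) ('X^m * p) = recip_poly n p.
Proof.
move=> size_p; rewrite recip_polyM ?size_polyXn //.
by rewrite recip_polyXn // subnn mul1r.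
Qed.

End ReciprocalPolynomial.

Lemma qpochM_fps_mul (F : fieldType) (q : F) (f g : nat -> F) n :
  qpoch q q n *
    fps_mul (fun k => f k / qpoch q q k) (fun k => g k / qpoch q q k) n =
  \sum_(k < n.+1) qbinom q n k * (f k * g (n - k)%N).
Proof.
rewrite mulr_sumr; apply: eq_bigr => k _.
by rewrite /qbinom -ltnS ltn_ord mulrACA -invfM mulrCA mulrC [X in _ / X]mulrC.
Qed.

Lemma fps_mul_qEulerian_gf (F : fieldType) (t q : F) n : t != 1 ->
  fps_mul (qEulerian_gf t q) (fun k => (t ^+ k - t) / qpoch q q k) n =
  (1 - t ^+ n) / qpoch q q n.
Proof.
move=> t_neq1; pose den m := qexp t q m - t * qexp 1 q m.
have den0 : den 0 != 0 by rewrite /den !qexp0 mulr1 subr_eq0 eq_sym.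
have := fps_divK (fun m => qexp 1 q m - qexp t q m) n den0.
rewrite {2}/qexp /qexp expr1n -mulrBl => <-; apply: eq_bigr => k _.
by rewrite /den /qexp expr1n mul1r mulrBl.
Qed.

Section QEulerian.

Variables (F : fieldType) (q : F).
Hypothesis q_neq1 : forall n : nat, (0 < n)%N -> q ^+ n != 1.

Local Notation qt := (q%:P%:F : {fraction {poly F}}).
Local Notation t := ('X%:F : {fraction {poly F}}).
Local Notation A := (qEulerian_poly q).

Lemma qbinomnn n : qbinom q n n = 1.
Proof.
by rewrite /qbinom leqnn subnn {2}/qpoch big_ord0 mul1r divff // qpoch_neq0.
Qed.

Lemma qbinom_frac n k : qbinom qt n k = (qbinom q n k)%:P%:F.
Proof.
rewrite /qbinom; case: ifP => _; last by rewrite polyC0 rmorph0.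
by rewrite invfM !qpochV_frac // qpoch_frac -!rmorphM invfM.
Qed.

Lemma sum_qbinom_qEulerian_poly n :
  \sum_(k < n.+1) qbinom q n k *: (A k * ('X^(n - k) - 'X)) = 1 - 'X^n.
Proof.
have t_neq1 : t != 1 by rewrite eq_sym -subr_eq0 fracX_neq1.
have qt_n : qpoch qt qt n != 0.
  by rewrite qpoch_frac tofrac_eq0 polyC_eq0 qpoch_neq0.
have sum_frac :
    \sum_(k < n.+1) qbinom qt n k * ((A k)%:F * (t ^+ (n - k) - t)) =
      1 - t ^+ n.
  have /= <- := qpochM_fps_mul qt (fun k => (A k)%:F) (fun k => t ^+ k - t) n.
  have := fps_mul_qEulerian_gf qt n t_neq1; rewrite /fps_mul => gf_eq.
  under eq_bigr => k _ do rewrite qEulerian_polyE //.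
  by rewrite gf_eq mulrC divfK.
apply/eqP; rewrite -tofrac_eq rmorphB rmorph1 rmorphXn /= -sum_frac rmorph_sum.
apply/eqP/eq_bigr => k _ /=.
by rewrite qbinom_frac -mul_polyC !rmorphM rmorphB rmorphXn.
Qed.

Lemma recip_qEulerian_poly n : recip_poly n (A n) = 'X * A n.
Proof.
elim/ltn_ind: n => -[_|n IHn].
  have -> : A 0 = 0 by apply/size_poly_leq0P/size_qEulerian_poly.
  by rewrite linear0 mulr0.
have size_A := size_qEulerian_poly q_neq1.
have A_eq : A n.+1 * (1 - 'X) = 1 - 'X^(n.+1) -
    \sum_(k < n.+1) qbinom q n.+1 k *: (A k * ('X^(n.+1 - k) - 'X)).
  rewrite -sum_qbinom_qEulerian_poly big_ord_recr /= qbinomnn scale1r subnn.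
  by rewrite expr0 addrAC subrr add0r.
have antisym : recip_poly n.+1 (A n.+1 * (1 - 'X)) = - (A n.+1 * (1 - 'X)).
  rewrite A_eq 2!linearB linear_sum /= recip_poly1 recip_polyXn // subnn expr0.
  rewrite !opprB [RHS]addrC -sumrN; congr (_ + _).
  apply: eq_bigr => k _; rewrite linearZ /=.
  rewrite -[X in recip_poly X _](subnKC (ltnW (ltn_ord k))).
  have size_Ak := leqW (size_A k).
  by rewrite recip_polyM_XnBX_antisym ?subn_gt0 ?IHn ?scalerN ?opprK.
have palindromic : recip_poly n (A n.+1) = A n.+1.
  have X_neq1 : 1 - 'X != 0 :> {poly F}.
    by rewrite -opprB oppr_eq0 -polyC1 polyXsubC_eq0.
  by apply/(mulIf X_neq1)/oppr_inj; rewrite -recip_polyM_1BX.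
by rewrite recip_polyS ?palindromic.
Qed.

Lemma coef_qEulerian_polyMXn a b k : (0 < b)%N -> (k <= a + b)%N ->
  (A k * 'X^(a + b - k))`_a = qEulerian q k b.-1.
Proof.
move=> b_gt0 le_k_ab; have size_A := size_qEulerian_poly q_neq1 k.
rewrite mulrC -[X in _`_X](addnK b a) -coef_recip_poly ?leq_addl //.
rewrite -[X in recip_poly X _](subnK le_k_ab) recip_polyXnM ?leqW //.
by rewrite recip_qEulerian_poly coefXM gtn_eqF.
Qed.

Lemma sum_qbinom_qEulerian_sym a b : (0 < a)%N -> (0 < b)%N ->
  \sum_(k < (a + b).+1) qbinom q (a + b) k * qEulerian q k a.-1 =
  \sum_(k < (a + b).+1) qbinom q (a + b) k * qEulerian q k b.-1.
Proof.
move=> a_gt0 b_gt0; apply/esym/eqP; rewrite -subr_eq0 -sumrB; apply/eqP.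
have coef_rhs : (1 - 'X^(a + b) : {poly F})`_a = 0.
  by rewrite coefB coef1 coefXn gtn_eqF // ltn_eqF ?subr0 // -ltn_subLR ?subnn.
rewrite -[RHS]coef_rhs -sum_qbinom_qEulerian_poly coef_sum.
apply: eq_bigr => k _; rewrite coefZ -mulrBr [A k * _]mulrBr coefB.
by rewrite coef_qEulerian_polyMXn ?leq_ord // coefMX gtn_eqF.
Qed.

End QEulerian.

Theorem theorem1 (a b : nat) (ha : (0 < a)%N) (hb : (0 < b)%N) :
  \sum_(k < (a + b).+1) qbinom qvar (a + b) k * qEulerian qvar k a.-1 =
  \sum_(k < (a + b).+1) qbinom qvar (a + b) k * qEulerian qvar k b.-1.
Proof. exact: sum_qbinom_qEulerian_sym qvar_neq1 _ _ ha hb. Qed.
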